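(* Let $0<\alpha<1$ and $p,q>0$. If $SG_{\alpha,p}(A,B)\le_{\mathrm{near}}\mathcal{A}_{\alpha,q}(A,B)$ for all positive definite $2\times2$ matrices $A,B$, then $q/p\ge1+\max\{\alpha(q-1),(1-\alpha)(q-1)\}$; hence $\frac{q}{p}\ge1+\max\{\alpha,1-\alpha\}(q-1)\ge1$ if $q\ge1$, and $\frac{q}{p}\ge1-\min\{\alpha,1-\alpha\}(1-q)\ge\max\{\alpha,1-\alpha\}$ if $0<q\le1$.
   Context: For positive definite $A,B$: $A\#B:=A^{1/2}(A^{-1/2}BA^{-1/2})^{1/2}A^{1/2}$; $F_\alpha(A,B):=(A^{-1}\#B)^\alpha A(A^{-1}\#B)^\alpha$; $SG_{\alpha,p}(A,B):=F_\alpha(A^p,B^p)^{1/p}$; $\mathcal{A}_{\alpha,q}(A,B):=((1-\alpha)A^q+\alpha B^q)^{1/q}$. For positive definite $X,Y$, $X\le_{\mathrm{near}}Y$ (near order) means $X\#Y^{-1}\le I$ in the Loewner order. *)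

(* Defs.v *)
From HB Require Import structures.
From mathcomp Require Import all_boot all_order all_algebra.
From mathcomp Require Import reals exp.
From mathcomp.real_closed Require Import complex.
Set Implicit Arguments. Unset Strict Implicit. Unset Printing Implicit Defensive.
Import Order.TTheory GRing.Theory Num.Theory.
Local Open Scope ring_scope.

Section Defs.
Variable R : realType.

Definition cR (x : R) : R[i] := Complex x 0.

Definition adjmx m n (M : 'M[R[i]]_(m, n)) : 'M[R[i]]_(n, m) :=
  (map_mx Num.conj M)^T.

Definition qform (M : 'M[R[i]]_2) (v : 'cV[R[i]]_2) : R[i] :=
  (adjmx v *m M *m v) 0 0.

(* positive semidefinite / positive definite (complex 2x2 matrices);
   over C, nonnegativity of all v^* M v forces M Hermitian. *)
Definition psd (M : 'M[R[i]]_2) : Prop := forall v, 0 <= qform M v.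
Definition posdef (M : 'M[R[i]]_2) : Prop := forall v, v != 0 -> 0 < qform M v.

Definition loewner_le (A B : 'M[R[i]]_2) : Prop := psd (B - A).

(* Real power A^t of a (Hermitian, positive definite) 2x2 matrix via the
   functional calculus, written with Lagrange interpolation on the
   eigenvalues l1 >= l2 = tr/2 +- sqrt((tr/2)^2 - det). *)
Definition mpow (A : 'M[R[i]]_2) (t : R) : 'M[R[i]]_2 :=
  let a := complex.Re (\tr A) / 2 in
  let d := Num.sqrt (a ^+ 2 - complex.Re (\det A)) in
  let l1 := a + d in
  let l2 := a - d in
  if d == 0 then (cR (powR l1 t))%:M
  else (cR (powR l1 t / (l1 - l2))) *: (A - (cR l2)%:M)
     - (cR (powR l2 t / (l1 - l2))) *: (A - (cR l1)%:M).

Definition gmean (A B : 'M[R[i]]_2) : 'M[R[i]]_2 :=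
  mpow A (2^-1) *m mpow (mpow A (- 2^-1) *m B *m mpow A (- 2^-1)) (2^-1)
  *m mpow A (2^-1).

Definition Falpha (alpha : R) (A B : 'M[R[i]]_2) : 'M[R[i]]_2 :=
  let G := gmean (invmx A) B in mpow G alpha *m A *m mpow G alpha.

Definition SG (alpha p : R) (A B : 'M[R[i]]_2) : 'M[R[i]]_2 :=
  mpow (Falpha alpha (mpow A p) (mpow B p)) (p^-1).

Definition Amean (alpha q : R) (A B : 'M[R[i]]_2) : 'M[R[i]]_2 :=
  mpow (cR (1 - alpha) *: mpow A q + cR alpha *: mpow B q) (q^-1).

Definition near_le (X Y : 'M[R[i]]_2) : Prop :=
  loewner_le (gmean X (invmx Y)) 1%:M.

End Defs.

(* Main.v *)
Require Import Defs.
From HB Require Import structures.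
From mathcomp Require Import all_boot all_order all_algebra.
From mathcomp Require Import reals exp.
From mathcomp.real_closed Require Import complex.
From mathcomp Require Import ring lra.
From mathcomp Require Import boolp classical_sets topology normedtype derive realfun.
Import Order.TTheory GRing.Theory Num.Theory.
Import numFieldNormedType.Exports.
Local Open Scope classical_set_scope.
Local Open Scope ring_scope.
Set Implicit Arguments. Unset Strict Implicit. Unset Printing Implicit Defensive.

(**
For positive definite P and G, the choice A = P^(1/p), B = (G P G)^(1/p) makes
A^-p # B^p equal to G, so that SG = X := (G^alpha P G^alpha)^(1/p).  The near
order X # Y^-1 <= 1 entails (tr X)^2 <= tr (X Y) + 2 sqrt (det X det Y).

Let e = (1, 0) and let v = (c, s) be a unit vector.  Take P -> e e^T, and G with
an eigenvalue c whose eigenvector tends to e while the other eigenvalue 1/x blows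
up at the rate for which G e -> v, so that G P G -> v v^T.
Then G^alpha P G^alpha -> c^(2 alpha) e e^T, and the trace inequality becomes
  c^(2 alpha / p) <= <e, ((1 - alpha) e e^T + alpha v v^T)^(1/q) e>.
Expanding to second order in s gives 1/p >= (1 - alpha)/q + alpha, that is
q/p >= 1 + alpha (q - 1).  Exchanging A and B turns G into G^-1 and alpha into
1 - alpha, which gives the other bound.
*)

(** * Entries, trace and determinant of 2x2 matrices *)

Lemma ord2P (i : 'I_2) : i = 0 \/ i = 1.
Proof.
by case: i => [[|[|//]] h]; [left | right]; apply: ord_inj.
Qed.

Section Matrix2.
Variable R : comPzRingType.
Implicit Types A B : 'M[R]_2.

Lemma big_ord2 (F : 'I_2 -> R) : \sum_i F i = F 0 + F 1.
Proof. by rewrite big_ord_recl big_ord1; congr (_ + F _); apply: ord_inj. Qed.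

Lemma eq_mx2 A B :
  A 0 0 = B 0 0 -> A 0 1 = B 0 1 -> A 1 0 = B 1 0 -> A 1 1 = B 1 1 -> A = B.
Proof.
move=> h00 h01 h10 h11; apply/matrixP=> i j.
by case: (ord2P i) => ->; case: (ord2P j) => ->.
Qed.

Lemma mulmx2E m n (A : 'M[R]_(m, 2)) (B : 'M[R]_(2, n)) i j :
  (A *m B) i j = A i 0 * B 0 j + A i 1 * B 1 j.
Proof. by rewrite mxE big_ord2. Qed.

Lemma mxtrace2E A : \tr A = A 0 0 + A 1 1.
Proof. by rewrite /mxtrace big_ord2. Qed.
End Matrix2.

Lemma det2E (R : comNzRingType) (A : 'M[R]_2) : \det A = A 0 0 * A 1 1 - A 0 1 * A 1 0.
Proof.
rewrite (expand_det_row _ 0) big_ord2 /cofactor !det_mx11 !mxE /=.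
rewrite (_ : lift 0 0 = 1 :> 'I_2); last exact: ord_inj.
rewrite (_ : lift 1 0 = 0 :> 'I_2); last exact: ord_inj.
by rewrite /= expr0 expr1 mul1r mulN1r mulrN.
Qed.

(** * Spectral calculus for real symmetric 2x2 matrices *)

Section RealMatrices.
Variable R : realType.
Implicit Types (A B E X Y Z : 'M[R]_2) (a b s t : R).

Definition disc A : R := Num.sqrt ((\tr A / 2) ^+ 2 - \det A).
Definition eig1 A : R := \tr A / 2 + disc A.
Definition eig2 A : R := \tr A / 2 - disc A.
Definition slope A t : R := (powR (eig1 A) t - powR (eig2 A) t) / (eig1 A - eig2 A).
(* [mpow] on real matrices; if [A] is scalar then [slope A t] is a quotient by 0,
   hence 0, and no case distinction is needed. *)
Definition rpow A t : 'M[R]_2 :=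
  slope A t *: A + (powR (eig1 A) t - slope A t * eig1 A)%:M.

Local Notation emb := (map_mx (real_complex R)).

Lemma cRE (x : R) : cR x = real_complex R x. Proof. by []. Qed.

(** A real matrix has real trace and determinant, so the interpolation has real coefficients. This
    allows the complex hypothesis to be tested on real matrices alone. *)
Lemma mpow_emb A t : mpow (emb A) t = emb (rpow A t).
Proof.
rewrite /mpow.
have -> : complex.Re (\tr (emb A)) = \tr A by rewrite !mxtrace2E !mxE.
have -> : complex.Re (\det (emb A)) = \det A.
  by rewrite !det2E !mxE /= !mul0r !subr0.
rewrite -/(disc A) -/(eig1 A) -/(eig2 A) /rpow /slope.
have e12 : eig1 A - eig2 A = disc A *+ 2 by rewrite /eig1 /eig2; ring.
case: eqP => [d0|/eqP d0].
  rewrite e12 d0 mul0rn invr0 mulr0 scale0r add0r mul0r subr0.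
  by rewrite cRE map_scalar_mx.
have dn : eig1 A - eig2 A != 0 by rewrite e12 mulrn_eq0.
apply/matrixP => i j; rewrite !mxE !cRE.
rewrite -!rmorphMn -!rmorphB -!rmorphM -!rmorphB; congr real_complex_def.
set D := eig1 A - eig2 A in dn *.
move: (powR _ _) (powR _ _) (A i j) => x y z.
case: (i == j); rewrite ?mulr1n ?mulr0n; last by field.
have -> : eig2 A = eig1 A - D by rewrite /D; ring.
by field.
Qed.

(* Orthogonal projections of rank one; [sp E a b] is then the generic symmetric
   matrix, with eigenvalues [a] and [b] in either order. *)
Definition projector E := [/\ E^T = E, E *m E = E & \tr E = 1].
Definition sp E a b : 'M[R]_2 := a *: E + b *: (1%:M - E).

Lemma projector_det E : projector E -> \det E = 0.
Proof.
case=> _ /matrixP EE; rewrite mxtrace2E det2E => tE.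
have := EE 0 0; rewrite mulmx2E => h.
have -> : E 1 1 = 1 - E 0 0 by rewrite -tE; ring.
by rewrite mulrBr mulr1 -addrA -opprD h subrr.
Qed.

Lemma projector_entries E : projector E ->
  [/\ E 1 0 = E 0 1, E 1 1 = 1 - E 0 0 & E 0 1 ^+ 2 = E 0 0 * (1 - E 0 0)].
Proof.
move=> pE; have := projector_det pE; case: pE => /matrixP sE _.
rewrite mxtrace2E det2E => tE.
have e10 : E 1 0 = E 0 1 by rewrite -[LHS]sE mxE.
have -> : E 1 1 = 1 - E 0 0 by rewrite -tE; ring.
by rewrite e10 => h; split => //; lra.
Qed.

Lemma projector_delta : projector (delta_mx 0 0).
Proof.
split; first by rewrite trmx_delta.
- by rewrite mul_delta_mx.
- by rewrite mxtrace2E !mxE /= addr0.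
Qed.

Lemma sp_scalar E a : sp E a a = a%:M.
Proof. by rewrite /sp scalerBr addrC subrK scalemx1. Qed.

Lemma sp_tr E a b : E^T = E -> (sp E a b)^T = sp E a b.
Proof. by move=> sE; rewrite /sp linearD !linearZ /= linearB /= sE trmx1. Qed.

Lemma sp_mul E a b c d : projector E -> sp E a b *m sp E c d = sp E (a * c) (b * d).
Proof.
case=> _ EE _; have EF : E *m (1%:M - E) = 0 by rewrite mulmxBr mulmx1 EE subrr.
have FE : (1%:M - E) *m E = 0 by rewrite mulmxBl mul1mx EE subrr.
have FF : (1%:M - E) *m (1%:M - E) = 1%:M - E by rewrite mulmxBl mul1mx EF subr0.
rewrite /sp mulmxDl !mulmxDr -!scalemxAl -!scalemxAr EE EF FE FF !scaler0 addr0 add0r.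
by rewrite !scalerA.
Qed.

Lemma sp_mxtrace E a b : \tr E = 1 -> \tr (sp E a b) = a + b.
Proof.
by move=> tE; rewrite /sp linearD !linearZ /= linearB /= tE mxtrace1; ring.
Qed.

Lemma sp_det E a b : projector E -> \det (sp E a b) = a * b.
Proof.
move=> /projector_entries[e10 e11 e01]; rewrite det2E /sp !mxE /= e10 e11.
rewrite mulr1n mulr0n.
have -> : forall x y z : R, x * y - z * z = x * y - z ^+ 2 by move=> *; ring.
rewrite (_ : a * E 0 1 + b * (0 - E 0 1) = (a - b) * E 0 1); last by ring.
by rewrite exprMn e01; ring.
Qed.

Lemma disc_sp E a b : projector E -> disc (sp E a b) = `|a - b| / 2.
Proof.
move=> pE; have [_ _ tE] := pE.
rewrite /disc sp_mxtrace // sp_det // (_ : _ - _ = ((a - b) / 2) ^+ 2); last by field.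
by rewrite sqrtr_sqr normrM [X in _ * X]ger0_norm // invr_ge0.
Qed.

(** [disc] is a nonnegative root and so orders the eigenvalues, whereas [sp] does not; the
    interpolation is symmetric in the two, so both orders agree. The laws of powers below follow
    from this formula. *)
Lemma rpow_sp E a b t : projector E -> rpow (sp E a b) t = sp E (powR a t) (powR b t).
Proof.
move=> pE; have [_ _ tE] := pE.
rewrite /rpow /slope /eig1 /eig2 disc_sp // sp_mxtrace //.
have [->|ab] := eqVneq a b.
  rewrite !subrr normr0 !mul0r !subr0 addr0 subrr mul0r scale0r add0r mul0r subr0.
  by rewrite sp_scalar (_ : (b + b) / 2 = b) //; field.
have ab0 : a - b != 0 by rewrite subr_eq0.
have ba0 : b - a != 0 by rewrite subr_eq0 eq_sym.
case: (ger0P (a - b)) => _.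
  rewrite (_ : (a + b) / 2 + _ = a); last by field.
  rewrite (_ : (a + b) / 2 - _ = b); last by field.
  by apply/matrixP=> i j; rewrite /sp !mxE; case: (i == j); rewrite ?mulr1n ?mulr0n; field.
rewrite (_ : (a + b) / 2 + _ = b); last by field.
rewrite (_ : (a + b) / 2 - _ = a); last by field.
by apply/matrixP=> i j; rewrite /sp !mxE; case: (i == j); rewrite ?mulr1n ?mulr0n; field.
Qed.

(** Spectral theorem without eigenvectors: by Cayley-Hamilton, (A - l2)/(l1 - l2) is a projection if
    the eigenvalues l1, l2 differ. Otherwise the discriminant, a sum of two squares, vanishes; then
    A is scalar and any projection serves. *)
Lemma sym_sp A : A^T = A -> exists E, projector E /\ A = sp E (eig1 A) (eig2 A).
Proof.
move=> /matrixP sA; have a10 : A 1 0 = A 0 1 by rewrite -[LHS]sA mxE.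
have disc2 : disc A ^+ 2 = ((A 0 0 - A 1 1) / 2) ^+ 2 + A 0 1 ^+ 2.
  rewrite /disc sqr_sqrtr mxtrace2E det2E a10; first by field.
  rewrite (_ : _ - _ = ((A 0 0 - A 1 1) / 2) ^+ 2 + A 0 1 ^+ 2); last by field.
  by rewrite addr_ge0 // sqr_ge0.
have [d0|d0] := eqVneq (disc A) 0.
  exists (delta_mx 0 0); split; first exact: projector_delta.
  rewrite /eig1 /eig2 d0 subr0 addr0 sp_scalar mxtrace2E.
  move/eqP: disc2; rewrite d0 expr0n /= eq_sym paddr_eq0 ?sqr_ge0 //.
  rewrite !sqrf_eq0 => /andP[/eqP h /eqP a01].
  by apply: eq_mx2; rewrite !mxE /= ?a10 ?a01 ?mulr1n ?mulr0n //; lra.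
have e12 : eig1 A - eig2 A = disc A *+ 2 by rewrite /eig1 /eig2; ring.
have dn : disc A *+ 2 != 0 by rewrite mulrn_eq0.
exists ((disc A *+ 2)^-1 *: (A - (eig2 A)%:M)); split.
  split.
  - rewrite linearZ /= linearB /= tr_scalar_mx; congr (_ *: (_ - _)).
    exact/matrixP.
  - rewrite -scalemxAl -scalemxAr scalerA.
    have -> : (A - (eig2 A)%:M) *m (A - (eig2 A)%:M) = (disc A *+ 2) *: (A - (eig2 A)%:M).
      rewrite /eig2 mxtrace2E.
      have D2 : A 0 1 * A 0 1 = disc A ^+ 2 - ((A 0 0 - A 1 1) / 2) ^+ 2.
        by rewrite disc2; ring.
      by apply: eq_mx2; rewrite mulmx2E !mxE /= ?a10 ?mulr1n ?mulr0n ?subr0 ?D2; field.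
    by rewrite scalerA mulfVK.
  - rewrite linearZ /= linearB /= mxtrace_scalar /eig2 !mxtrace2E.
    by field.
apply/matrixP=> i j; rewrite /sp !mxE (_ : eig1 A = eig2 A + disc A *+ 2).
  by case: (i == j); rewrite ?mulr1n ?mulr0n; field.
by rewrite -e12; ring.
Qed.

(** Positive definiteness in the form of Sylvester's criterion. *)
Definition spd A := [/\ A^T = A, 0 < A 0 0 & 0 < \det A].

Lemma spd_sp E a b : projector E -> 0 < a -> 0 < b -> spd (sp E a b).
Proof.
move=> pE a0 b0; have [sE _ _] := pE; split; first exact: sp_tr.
  have [_ _ h] := projector_entries pE.
  rewrite /sp !mxE /= mulr1n; have := sqr_ge0 (E 0 1); rewrite h => h1.
  (* The two diagonal entries of E have a square as product and 1 as sum, so neither is negative. *)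
  have [e0 e1] : 0 <= E 0 0 /\ 0 <= 1 - E 0 0 by split; nra.
  by nra.
by rewrite sp_det // mulr_gt0.
Qed.

Lemma spd_11 A : spd A -> 0 < A 1 1.
Proof.
case=> /matrixP sA a0; have a10 : A 1 0 = A 0 1 by rewrite -[LHS]sA mxE.
rewrite det2E a10 subr_gt0 => h; rewrite -(pmulr_rgt0 _ a0).
by apply: le_lt_trans h; rewrite -expr2 sqr_ge0.
Qed.

Lemma spd_eig_gt0 A : spd A -> 0 < eig1 A /\ 0 < eig2 A.
Proof.
move=> hA; have [sA a0 d0] := hA; have [E [pE eA]] := sym_sp sA.
have [_ _ tE] := pE.
have trp : 0 < eig1 A + eig2 A.
  by rewrite -(sp_mxtrace _ _ tE) -eA mxtrace2E addr_gt0 // spd_11.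
have dtp : 0 < eig1 A * eig2 A by rewrite -(sp_det _ _ pE) -eA.
by split; nra.
Qed.

Lemma spdP A : spd A -> exists E a b, [/\ projector E, 0 < a, 0 < b & A = sp E a b].
Proof.
move=> hA; have [sA _ _] := hA; have [e1 e2] := spd_eig_gt0 hA.
have [E [pE eA]] := sym_sp sA.
by exists E, (eig1 A), (eig2 A).
Qed.

Lemma spd_rpow A t : spd A -> spd (rpow A t).
Proof.
by case/spdP=> E [a] [b] [pE a0 b0 ->]; rewrite rpow_sp //; apply: spd_sp; rewrite ?powR_gt0.
Qed.

Lemma rpowD A s t : spd A -> rpow A s *m rpow A t = rpow A (s + t).
Proof.
case/spdP=> E [a] [b] [pE a0 b0 ->]; rewrite !rpow_sp // sp_mul //.
by rewrite !powRD // ?(gt_eqF a0) ?(gt_eqF b0) implybT.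
Qed.

Lemma rpowM A s t : spd A -> rpow (rpow A s) t = rpow A (s * t).
Proof. by case/spdP=> E [a] [b] [pE a0 b0 ->]; rewrite !rpow_sp // -!powRrM. Qed.

Lemma rpow0 A : spd A -> rpow A 0 = 1%:M.
Proof. by case/spdP=> E [a] [b] [pE a0 b0 ->]; rewrite !rpow_sp // !powRr0 sp_scalar. Qed.

Lemma rpow1 A : spd A -> rpow A 1 = A.
Proof.
by case/spdP=> E [a] [b] [pE a0 b0 ->]; rewrite !rpow_sp // !powRr1 // ltW.
Qed.

Lemma rpowNK A t : spd A -> rpow A (- t) *m rpow A t = 1%:M.
Proof. by move=> hA; rewrite rpowD // addNr rpow0. Qed.

Lemma rpowKN A t : spd A -> rpow A t *m rpow A (- t) = 1%:M.
Proof. by move=> hA; rewrite rpowD // subrr rpow0. Qed.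

Lemma spd_unit A : spd A -> A \in unitmx.
Proof. by case=> _ _ d0; rewrite unitmxE unitfE gt_eqF. Qed.

Lemma rpow_inv A t : spd A -> invmx (rpow A t) = rpow A (- t).
Proof.
move=> hA; have u := spd_unit (spd_rpow t hA).
by rewrite -[LHS]mul1mx -(rpowNK t hA) mulmxK.
Qed.

Lemma invmx_rpow A : spd A -> invmx A = rpow A (- 1).
Proof. by move=> hA; rewrite -[in LHS](rpow1 hA) rpow_inv. Qed.

Lemma spd_inv A : spd A -> spd (invmx A).
Proof. by move=> hA; rewrite invmx_rpow //; apply: spd_rpow. Qed.

Lemma spd_sym A : spd A -> A^T = A. Proof. by case. Qed.

Lemma rpow_half A : spd A -> rpow A (2^-1) *m rpow A (2^-1) = A.
Proof. by move=> hA; rewrite rpowD // (_ : 2^-1 + 2^-1 = 1) ?rpow1 //; field. Qed.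

Lemma rpow_sqr A : spd A -> rpow (A *m A) (2^-1) = A.
Proof.
move=> hA; rewrite -{1 2}(rpow1 hA) rpowD // rpowM //.
by rewrite (_ : (1 + 1) * 2^-1 = 1) ?rpow1 //; field.
Qed.

Lemma spd_gram (N : 'M[R]_2) : N \in unitmx -> spd (N *m N^T).
Proof.
rewrite unitmxE unitfE => uN; split; first by rewrite trmx_mul trmxK.
  rewrite mulmx2E !mxE -!expr2 lt0r addr_ge0 ?sqr_ge0 // andbT.
  rewrite paddr_eq0 ?sqr_ge0 // !sqrf_eq0; apply: contra uN => /andP[/eqP h1 /eqP h2].
  by rewrite det2E h1 h2 !mul0r subrr.
by rewrite det_mulmx det_tr -expr2 lt0r sqrf_eq0 uN sqr_ge0.
Qed.

Lemma spd_congr A (C : 'M[R]_2) : spd A -> C \in unitmx -> spd (C *m A *m C^T).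
Proof.
move=> hA uC; rewrite -(rpow_half hA); set B := rpow A _.
have hB : spd B by exact: spd_rpow.
rewrite mulmxA -{2}(spd_sym hB) -(mulmxA _ B^T) -trmx_mul.
by apply: spd_gram; rewrite unitmx_mul uC spd_unit.
Qed.

Lemma spd_conj A C : spd A -> spd C -> spd (C *m A *m C).
Proof.
by move=> hA hC; rewrite -{2}(spd_sym hC); apply: spd_congr => //; apply: spd_unit.
Qed.

Lemma spdZ a A : 0 < a -> spd A -> spd (a *: A).
Proof.
move=> a0 [sA A0 dA]; split; first by rewrite linearZ /= sA.
  by rewrite mxE mulr_gt0.
by rewrite detZ mulr_gt0 // exprn_gt0.
Qed.

Lemma spdD A B : spd A -> spd B -> spd (A + B).
Proof.
move=> hA hB; have A1 := spd_11 hA; have B1 := spd_11 hB.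
case: hA => sA A0 dA; case: hB => sB B0 dB.
split; first by rewrite linearD /= sA sB.
  by rewrite mxE addr_gt0.
have a10 : A 1 0 = A 0 1 by rewrite -{1}sA mxE.
have b10 : B 1 0 = B 0 1 by rewrite -{1}sB mxE.
move: dA dB; rewrite !det2E !mxE a10 b10.
set a := A 0 0 in A0 *; set d := A 1 1 in A1 *; set b := A 0 1.
set a' := B 0 0 in B0 *; set d' := B 1 1 in B1 *; set b' := B 0 1.
move=> dA dB.
(* The determinant of A + B is det A + det B + (a d' + a' d - 2 b b'). The bracket is nonnegative by
   AM-GM: (a d' + a' d)^2 >= 4 a d a' d' >= 4 b^2 b'^2. *)
suff : 2 * b * b' <= a * d' + a' * d by nra.
have [|h0] := leP (2 * b * b') 0; first by move/le_trans; apply; nra.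
rewrite -(@ler_pXn2r _ 2) // ?nnegrE ?(ltW h0) //; last by nra.
have h1 : b ^+ 2 <= a * d by nra.
have h2 : b' ^+ 2 <= a' * d' by nra.
have h3 : b ^+ 2 * b' ^+ 2 <= (a * d) * (a' * d') by apply: ler_pM; rewrite ?sqr_ge0.
by have := sqr_ge0 (a * d' - a' * d); nra.
Qed.

End RealMatrices.

(** * Geometric mean, Riccati equation and the trace inequality *)

Section Means.
Variable R : realType.
Implicit Types (A B E G P X Y Z : 'M[R]_2) (a b s t : R).

Definition rgmean A B : 'M[R]_2 :=
  rpow A (2^-1) *m rpow (rpow A (- 2^-1) *m B *m rpow A (- 2^-1)) (2^-1) *m rpow A (2^-1).

(** With S = P^(1/2), S (G P G) S = (S G S)^2, so the inner root is explicit. This makes the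
    geometric mean inside SG a free parameter G. *)
Lemma rgmean_conj P G : spd P -> spd G -> rgmean (invmx P) (G *m P *m G) = G.
Proof.
move=> hP hG; rewrite /rgmean invmx_rpow // !rpowM // mulrNN !mulN1r mul1r.
set S := rpow P (2^-1).
have -> : S *m (G *m P *m G) *m S = (S *m G *m S) *m (S *m G *m S).
  by rewrite -{1}(rpow_half hP) -/S !mulmxA.
rewrite rpow_sqr; last by apply: spd_conj => //; apply: spd_rpow.
by rewrite !mulmxA rpowNK // mul1mx -mulmxA rpowKN // mulmx1.
Qed.

Lemma spd_rgmean A B : spd A -> spd B -> spd (rgmean A B).
Proof. by move=> hA hB; do 4?[apply: spd_conj || apply: spd_rpow]. Qed.

(** In Z X^-1 Z the half powers of X cancel and the root gets squared, which leaves Y^-1.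
    Multiplying by Z Y on the left and cancelling Z on the right gives Z Y Z X^-1 = 1. *)
Lemma rgmean_riccati X Y : spd X -> spd Y ->
  let Z := rgmean X (invmx Y) in Z *m Y *m Z = X.
Proof.
move=> hX hY Z; have hZ : spd Z by apply: spd_rgmean => //; apply: spd_inv.
have h : Z *m invmx X *m Z = invmx Y.
  rewrite /Z /rgmean; set W := rpow (_ *m _) _.
  rewrite -[X in invmx X](rpow1 hX) rpow_inv // !mulmxA.
  rewrite -(mulmxA _ (rpow X (2^-1)) (rpow X (-1))) rpowD //.
  rewrite -(mulmxA _ (rpow X _) (rpow X (2^-1))) rpowD //.
  rewrite (_ : 2^-1 + -1 + 2^-1 = 0) ?rpow0 ?mulmx1; [|by []|by field].
  rewrite -(mulmxA _ W W) rpow_half; last first.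
    by apply: spd_conj; [apply: spd_inv | apply: spd_rpow].
  by rewrite !mulmxA rpowKN // mul1mx -mulmxA rpowNK // mulmx1.
have uZ := spd_unit hZ; have uX := spd_unit hX; have uY := spd_unit hY.
have e : Z *m Y *m Z *m (invmx X *m Z) = Z.
  by rewrite -(mulmxA _ Z) (mulmxA Z (invmx X)) h -mulmxA mulmxV // mulmx1.
have : Z *m Y *m Z *m invmx X = 1%:M by rewrite -[LHS](mulmxK uZ) -(mulmxA (Z *m Y *m Z)) e mulmxV.
by move=> e1; rewrite -[RHS]mul1mx -e1 mulmxKV.
Qed.

(** The trace equals tr (E Y E) = tr (N N^T) with N = E Y^(1/2), a sum of squares. *)
Lemma mxtrace_mul_projector_ge0 Y E : spd Y -> projector E -> 0 <= \tr (Y *m E).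
Proof.
move=> hY [sE EE _]; rewrite -EE mulmxA mxtrace_mulC mulmxA -(rpow_half hY).
set W := rpow _ _; have sW : W^T = W by apply: spd_sym; apply: spd_rpow.
have -> : E *m (W *m W) *m E = (E *m W) *m (E *m W)^T.
  by rewrite trmx_mul sW sE !mulmxA.
move: (E *m W) => N; rewrite mxtrace2E !mulmx2E ![N^T _ _]mxE -!expr2.
by rewrite !addr_ge0 ?sqr_ge0.
Qed.

Lemma projector_compl E : projector E -> projector (1%:M - E).
Proof.
case=> sE EE tE; split; first by rewrite linearB /= sE trmx1.
  by rewrite mulmxBl mul1mx mulmxBr mulmx1 EE subrr subr0.
by rewrite linearB /= tE mxtrace1; ring.
Qed.

Lemma sqr_mxtrace2 (A : 'M[R]_2) : (\tr A) ^+ 2 = \tr (A *m A) + 2 * \det A.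
Proof. by rewrite !mxtrace2E det2E !mulmx2E; ring. Qed.

(* [Z := X # Y^-1] satisfies [Z Y Z = X] and [Z <= 1], so
   [tr X = tr (Y Z^2) <= tr (Y Z)]; square this with Cayley-Hamilton. *)
Lemma rgmean_le1_mxtrace X Y : spd X -> spd Y ->
  (forall v : 'cV[R]_2, 0 <= (v^T *m (1%:M - rgmean X (invmx Y)) *m v) 0 0) ->
  (\tr X) ^+ 2 <= \tr (X *m Y) + 2 * Num.sqrt (\det X * \det Y).
Proof.
move=> hX hY; have := rgmean_riccati hX hY; have := spd_rgmean hX (spd_inv hY).
move: (rgmean _ _) => Z /= hZ ZYZ le1.
have -> : Num.sqrt (\det X * \det Y) = \det (Y *m Z).
  rewrite -ZYZ !det_mulmx (_ : _ * _ = (\det Y * \det Z) ^+ 2); last by ring.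
  rewrite sqrtr_sqr ger0_norm //.
  by case: hY => _ _ /ltW dY; case: hZ => _ _ /ltW dZ; rewrite mulr_ge0.
have -> : \tr (X *m Y) = \tr ((Y *m Z) *m (Y *m Z)).
  by rewrite -ZYZ mxtrace_mulC !mulmxA.
rewrite -sqr_mxtrace2.
have tX : 0 <= \tr X.
  by rewrite mxtrace2E; have := spd_11 hX; case: hX => _ ? _ ?; rewrite addr_ge0 // ltW.
suff h : \tr X <= \tr (Y *m Z) by rewrite ler_pXn2r // nnegrE // (le_trans tX).
have -> : \tr X = \tr (Y *m (Z *m Z)) by rewrite -ZYZ -mulmxA mxtrace_mulC mulmxA.
have [E [a] [b] [pE a0 b0 eZ]] := spdP hZ.
have pF := projector_compl pE.
(* An eigenvalue c of 1 - Z is read off by summing the quadratic form over the columns of its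
   eigenprojection G: the sum is c tr (G^T G) = c. *)
have le1' G c : projector G -> (1%:M - Z) *m G = c *: G -> 0 <= c.
  case=> sG GG tG eG.
  have := addr_ge0 (le1 (col 0 G)) (le1 (col 1 G)).
  rewrite -!(mulmxA _ (_ - _)) !colE !(mulmxA _ G) eG -!colE.
  have -> : ((col 0 G)^T *m col 0 (c *: G)) 0 0 + ((col 1 G)^T *m col 1 (c *: G)) 0 0
    = c * \tr (G^T *m G).
    by rewrite mxtrace2E !mulmx2E !mxE; ring.
  by rewrite sG GG tG mulr1.
have ZE : (1%:M - Z) *m E = (1 - a) *: E.
  case: pE => _ EE _.
  rewrite mulmxBl mul1mx eZ /sp mulmxDl -!scalemxAl mulmxBl mul1mx EE subrr scaler0 addr0.
  by rewrite scalerBl scale1r.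
have ZF : (1%:M - Z) *m (1%:M - E) = (1 - b) *: (1%:M - E).
  case: pE pF => _ EE _ [_ FF _].
  rewrite mulmxBl mul1mx eZ /sp mulmxDl -!scalemxAl FF mulmxBr mulmx1 EE subrr scaler0 add0r.
  by rewrite scalerBl scale1r.
have a1 := le1' _ _ pE ZE; have b1 := le1' _ _ pF ZF.
(* The eigenvalues of Z lie in (0, 1], so a^2 <= a and b^2 <= b; the two spectral terms are compared
   separately. *)
rewrite eZ sp_mul // /sp !mulmxDr -!scalemxAr !mxtraceD !mxtraceZ.
have := mxtrace_mul_projector_ge0 hY pE; have := mxtrace_mul_projector_ge0 hY pF.
by move=> f0 e0; apply: lerD; apply: ler_wpM2r => //; nra.
Qed.

(** * Transfer of the near-order hypothesis to real matrices *)

Local Notation emb := (map_mx (real_complex R)).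

Lemma gmean_emb A B : gmean (emb A) (emb B) = emb (rgmean A B).
Proof. by rewrite /gmean /rgmean !mpow_emb -!map_mxM mpow_emb -!map_mxM. Qed.

Lemma adjmx_emb m n (A : 'M[R]_(m, n)) : adjmx (emb A) = emb A^T.
Proof. by apply/matrixP=> i j; rewrite !mxE conj_Creal // complex_real. Qed.

(** [posdef] ranges over complex vectors; there the form is the squared norm of A^(1/2) v, and
    A^(1/2) is invertible. *)
Lemma posdef_emb A : spd A -> posdef (emb A).
Proof.
move=> hA v v0; rewrite /qform -(rpow_half hA).
set W := rpow A _; have hW : spd W by apply: spd_rpow.
have uW : emb W \in unitmx by rewrite map_unitmx spd_unit.
have -> : adjmx v *m emb (W *m W) *m v = adjmx (emb W *m v) *m (emb W *m v).
  rewrite /adjmx map_mxM [in RHS]map_mxM /= trmx_mul.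
  have /= := adjmx_emb W; rewrite /adjmx (spd_sym hW) => ->.
  by rewrite !mulmxA.
set w := emb W *m v.
have w0 : w != 0.
  by apply: contra v0 => /eqP w0; rewrite -[v](mulKmx uW) -/w w0 mulmx0.
move: w w0 => {}w w0.
rewrite mulmx2E !mxE ![_^* * _]mulrC -!normCK lt0r addr_ge0 ?exprn_ge0 // andbT.
rewrite paddr_eq0 ?exprn_ge0 // !expf_eq0 /= !normr_eq0.
apply: contra w0 => /andP[/eqP h0 /eqP h1]; apply/eqP/matrixP=> i j.
by rewrite (ord1 j) mxE; case: (ord2P i) => ->.
Qed.

Lemma near_le_emb X Y : near_le (emb X) (emb Y) ->
  forall v : 'cV[R]_2, 0 <= (v^T *m (1%:M - rgmean X (invmx Y)) *m v) 0 0.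
Proof.
move=> h v; have := h (emb v).
rewrite /qform -map_invmx gmean_emb adjmx_emb.
have -> : 1%:M - emb (rgmean X (invmx Y)) = emb (1%:M - rgmean X (invmx Y)).
  by rewrite map_mxB map_mx1.
by rewrite -!map_mxM mxE ler0c.
Qed.

(** The trace consequence of the near order for X = SG and Y the arithmetic mean, at A = P^(1/p) and
    B = (G P G)^(1/p); hence A^q = P^(q/p). *)
Definition mean_trace_ineq alpha p q P G :=
  let X := rpow (rpow G alpha *m P *m rpow G alpha) p^-1 in
  let Y := rpow ((1 - alpha) *: rpow P (q / p) + alpha *: rpow (G *m P *m G) (q / p)) q^-1 in
  (\tr X) ^+ 2 <= \tr (X *m Y) + 2 * Num.sqrt (\det X * \det Y).

Section NearOrder.
Variables alpha p q : R.
Hypotheses (alpha_gt0 : 0 < alpha) (alpha_lt1 : alpha < 1) (p_gt0 : 0 < p).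
Hypothesis near_means : forall A B : 'M[R[i]]_2, posdef A -> posdef B ->
  near_le (SG alpha p A B) (Amean alpha q A B).

Lemma near_mean_trace_ineq P G : spd P -> spd G -> mean_trace_ineq alpha p q P G.
Proof.
move=> hP hG; have hQ : spd (G *m P *m G) by apply: spd_conj.
have hA : spd (rpow P p^-1) by apply: spd_rpow.
have hB : spd (rpow (G *m P *m G) p^-1) by apply: spd_rpow.
have := near_means (posdef_emb hA) (posdef_emb hB).
rewrite /SG /Amean /Falpha !mpow_emb !rpowM // mulVf ?gt_eqF // !rpow1 //.
rewrite -map_invmx gmean_emb rgmean_conj // mpow_emb -!map_mxM mpow_emb.
rewrite !cRE -!map_mxZ -map_mxD mpow_emb [p^-1 * q]mulrC => /near_le_emb.
apply: rgmean_le1_mxtrace; apply: spd_rpow.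
  by apply: spd_conj => //; apply: spd_rpow.
by apply: spdD; apply: spdZ; rewrite ?subr_gt0 //; apply: spd_rpow.
Qed.

(* Exchanging [A] and [B] turns [G] into [G^-1] and [alpha] into [1 - alpha]. *)
Lemma near_mean_trace_ineq_swap P G :
  spd P -> spd G -> mean_trace_ineq (1 - alpha) p q P G.
Proof.
move=> hP hG; have hQ : spd (G *m P *m G) by apply: spd_conj.
(* The roles are exchanged by taking G P G for P and G^-1 for G. *)
have := near_mean_trace_ineq hQ (spd_inv hG); rewrite /mean_trace_ineq.
have uG := spd_unit hG.
have -> : invmx G *m (G *m P *m G) *m invmx G = P.
  by rewrite !mulmxA mulVmx // mul1mx mulmxK.
have -> : rpow (invmx G) alpha *m (G *m P *m G) *m rpow (invmx G) alpha =
    rpow G (1 - alpha) *m P *m rpow G (1 - alpha).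
  rewrite invmx_rpow // rpowM // mulN1r [in LHS](_ : G *m P *m G = rpow G 1 *m P *m rpow G 1).
    rewrite -!mulmxA rpowD // !mulmxA rpowD //.
    by rewrite [- alpha + 1]addrC.
  by rewrite rpow1.
by rewrite subKr [alpha *: _ + _]addrC.
Qed.

End NearOrder.
End Means.

(** * Continuity of matrix powers up to singular matrices *)

Section Limits.
Variables (R : realType).

(** The limit y = 0 must be allowed because the limit matrices are singular. There differentiability
    is replaced by an estimate: |f x| < e^(1/t) gives (f x)^t < e. *)
Lemma cvg_powR (T : Type) (F : set_system T) {FF : Filter F} (f : T -> R) (y t : R) :
  0 < t -> 0 <= y -> (\forall x \near F, 0 <= f x) ->
  f x @[x --> F] --> y -> powR (f x) t @[x --> F] --> powR y t.
Proof.
move=> t0; rewrite le_eqVlt => /orP[/eqP <- f0 fc|y0 _ fc]; last first.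
  apply: (@continuous_cvg _ _ _ F FF f (fun u => powR u t) y) => //.
  apply: differentiable_continuous; apply/derivable1_diffP.
  by have [] := is_derive1_powR t y0.
rewrite powR0 ?gt_eqF //; apply/cvgrPdist_lt => e e0.
move/cvgrPdist_lt : fc => /(_ (powR e t^-1) (powR_gt0 _ e0)) fc.
near=> x.
have fx0 : 0 <= f x by near: x.
have : `|0 - f x| < powR e t^-1 by near: x.
rewrite !sub0r !normrN !ger0_norm ?powR_ge0 // => fx.
rewrite -[e](@powRr1 _ _ (ltW e0)) -(@mulVf _ t) ?gt_eqF // powRrM.
by apply: gt0_ltr_powR; rewrite // nnegrE ?powR_ge0.
Unshelve. all: by end_near. Qed.

Section Matrices.
Variables (T : topologicalType) (F : set_system T).
Context {FF : ProperFilter F}.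
Implicit Types (A B : T -> 'M[R]_2) (M N : 'M[R]_2).

Definition mxcvg A M := forall i j, A x i j @[x --> F] --> M i j.

Lemma mxcvg_mul A B M N :
  mxcvg A M -> mxcvg B N -> mxcvg (fun x => A x *m B x) (M *m N).
Proof.
move=> hA hB i j; rewrite mulmx2E; under eq_fun do rewrite mulmx2E.
by apply: cvgD; apply: cvgM.
Qed.

Lemma mxcvgD A B M N :
  mxcvg A M -> mxcvg B N -> mxcvg (fun x => A x + B x) (M + N).
Proof.
by move=> hA hB i j; rewrite mxE; under eq_fun do rewrite mxE; apply: cvgD.
Qed.

Lemma mxcvgZ A M (k : T -> R) (k0 : R) :
  k x @[x --> F] --> k0 -> mxcvg A M -> mxcvg (fun x => k x *: A x) (k0 *: M).
Proof.
by move=> hk hA i j; rewrite mxE; under eq_fun do rewrite mxE; apply: cvgM.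
Qed.

Lemma mxcvg_scalar (k : T -> R) (k0 : R) :
  k x @[x --> F] --> k0 -> mxcvg (fun x => (k x)%:M) k0%:M.
Proof.
by move=> hk i j; rewrite mxE; under eq_fun do rewrite mxE; apply: cvgMn.
Qed.

Lemma cvg_mxtrace A M : mxcvg A M -> \tr (A x) @[x --> F] --> \tr M.
Proof.
by move=> h; rewrite mxtrace2E; under eq_fun do rewrite mxtrace2E; apply: cvgD.
Qed.

Lemma cvg_det A M : mxcvg A M -> \det (A x) @[x --> F] --> \det M.
Proof.
move=> h; rewrite det2E; under eq_fun do rewrite det2E.
by apply: cvgB; apply: cvgM.
Qed.

Lemma cvg_sqrt (f : T -> R) y :
  f x @[x --> F] --> y -> Num.sqrt (f x) @[x --> F] --> Num.sqrt y.
Proof. by apply: continuous_cvg; exact: sqrt_continuous. Qed.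

(** Distinct eigenvalues of M keep the denominator of [slope] away from 0. M itself may be singular:
    its eigenvalues are only nonnegative, as limits of positive ones. *)
Lemma mxcvg_rpow A M t : 0 < t -> (\forall x \near F, spd (A x)) ->
  0 < disc M -> mxcvg A M -> mxcvg (fun x => rpow (A x) t) (rpow M t).
Proof.
move=> t0 sA d0 cA.
have ctr : \tr (A x) / 2 @[x --> F] --> \tr M / 2.
  by apply: cvgM; [exact: cvg_mxtrace | exact: cvg_cst].
have cdisc : disc (A x) @[x --> F] --> disc M.
  apply: cvg_sqrt; apply: cvgB; last exact: cvg_det.
  by rewrite expr2; under eq_fun do rewrite expr2; apply: cvgM.
have c1 : eig1 (A x) @[x --> F] --> eig1 M by apply: cvgD.
have c2 : eig2 (A x) @[x --> F] --> eig2 M by apply: cvgB.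
have n1 : \forall x \near F, 0 <= eig1 (A x).
  by apply: filterS sA => x /spd_eig_gt0[/ltW].
have n2 : \forall x \near F, 0 <= eig2 (A x).
  by apply: filterS sA => x /spd_eig_gt0[_ /ltW].
have e1 : 0 <= eig1 M by exact: (ler_cvg_to (cvg_cst (0 : R)) c1 n1).
have e2 : 0 <= eig2 M by exact: (ler_cvg_to (cvg_cst (0 : R)) c2 n2).
have p1 := cvg_powR t0 e1 n1 c1.
have p2 := cvg_powR t0 e2 n2 c2.
have cs : slope (A x) t @[x --> F] --> slope M t.
  apply: cvgM; first by apply: cvgB; [exact: p1 | exact: p2].
  apply: cvgV; last by apply: cvgB; [exact: c1 | exact: c2].
  rewrite (_ : _ - _ = disc M *+ 2) ?mulrn_eq0 ?gt_eqF //.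
  by rewrite /eig1 /eig2; ring.
apply: mxcvgD; first by apply: mxcvgZ; [exact: cs | exact: cA].
apply: mxcvg_scalar; apply: cvgB; first exact: p1.
apply: cvgM; [exact: cs|exact: c1].
Qed.

End Matrices.
End Limits.

Ltac cvg_arith := repeat first
  [ assumption | exact: cvg_cst | apply: cvgM | apply: cvgD | apply: cvgN ].

(** * The degenerating family of test matrices and its limit *)

Section Family.
Variable R : realType.
Implicit Types (u v c s x : R).

Definition outer u v : 'M[R]_2 :=
  \matrix_(i, j) ((if i == 0 then u else v) * (if j == 0 then u else v)).

Lemma projector_outer c s : c ^+ 2 + s ^+ 2 = 1 -> projector (outer c s).
Proof.
move=> cs; split.
- by apply/matrixP=> i j; rewrite !mxE mulrC.
- apply/matrixP=> i j; rewrite mulmx2E !mxE /=.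
  set a := if _ then _ else _; set b := if _ then _ else _.
  by rewrite -[RHS]mulr1 -cs; ring.
- by rewrite mxtrace2E !mxE /= -!expr2.
Qed.

(* The projection onto the line spanned by (1, -x). *)
Definition tilt x : 'M[R]_2 := (1 + x * x)^-1 *: outer 1 (- x).

Lemma tilt_den x : 1 + x * x != 0 :> R.
Proof. by rewrite gt_eqF // -expr2 ltr_wpDr // sqr_ge0. Qed.

Lemma projector_tilt x : projector (tilt x).
Proof.
have x0 := tilt_den x.
split; first by apply/matrixP=> i j; rewrite !mxE [X in _ * X]mulrC.
- by apply: eq_mx2; rewrite mulmx2E !mxE /=; field.
- by rewrite mxtrace2E !mxE /=; field.
Qed.

Lemma mxcvg_outer (T : topologicalType) (F : set_system T) {FF : ProperFilter F}
    (f g : T -> R) u v :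
  f y @[y --> F] --> u -> g y @[y --> F] --> v ->
  mxcvg F (fun y => outer (f y) (g y)) (outer u v).
Proof.
move=> cf cg i j; rewrite mxE; under eq_fun do rewrite mxE.
by apply: cvgM; case: ifP.
Qed.

Lemma cvg_at0_id : x @[x --> (0:R)^'+] --> (0 : R).
Proof. by apply: cvg_at_right_filter; exact: cvg_id. Qed.

(* The outer factors have entries of order 1/x; the weight x^4 makes these harmless. *)
Lemma mxcvg_tilt_conj s (k : R) (l : R) (K : R -> R) :
  x * K x @[x --> (0:R)^'+] --> l ->
  mxcvg (0:R)^'+ (fun x => sp (tilt (s * x)) k (K x) *m sp (outer 1 0) 1 (x ^+ 4)
     *m sp (tilt (s * x)) k (K x)) (outer k (s * l)).
Proof.
move=> cK.
have c0 := cvg_at0_id.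
have cD : (1 + (s * x) * (s * x))^-1 @[x --> (0:R)^'+] --> (1:R).
  rewrite -[X in _ --> X]invr1; apply: cvgV; first exact: oner_neq0.
  rewrite [X in _ --> X](_ : _ = 1 + (s * 0) * (s * 0)); last by ring.
  by cvg_arith.
(* With N the outer factor and e, f the standard basis, (g0, g1) = N e and (x^2 g1, h) = x^2 N f.
   [K x] is grouped as x * K x, whose limit is known. *)
pose g0 x := (k + s * s * x * (x * K x)) * (1 + (s * x) * (s * x))^-1.
pose g1 x := (s * (x * K x) - k * (s * x)) * (1 + (s * x) * (s * x))^-1.
pose h x := (k * (s * x) * (s * x) * x * x + x * (x * K x)) * (1 + (s * x) * (s * x))^-1.
have c_g0 : g0 x @[x --> (0:R)^'+] --> k.
  rewrite [X in _ --> X](_ : _ = (k + s * s * 0 * l) * 1); last by ring.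
  by cvg_arith.
have c_g1 : g1 x @[x --> (0:R)^'+] --> s * l.
  rewrite [X in _ --> X](_ : _ = (s * l - k * (s * 0)) * 1); last by ring.
  by cvg_arith.
have c_h : h x @[x --> (0:R)^'+] --> (0 : R).
  rewrite [X in _ --> X](_ : _ = (k * (s * 0) * (s * 0) * 0 * 0 + 0 * l) * 1); last by ring.
  by cvg_arith.
have NE x : sp (tilt (s * x)) k (K x) *m sp (outer 1 0) 1 (x ^+ 4) *m sp (tilt (s * x)) k (K x)
    = outer (g0 x) (g1 x) + outer (x * x * g1 x) (h x).
  have D0 := tilt_den (s * x).
  by apply: eq_mx2; rewrite !mulmx2E /sp !mxE /= /g0 /g1 /h ?mulr1n ?mulr0n; field.
rewrite (funext NE) (_ : outer k (s * l) = outer k (s * l) + outer (0 * 0 * (s * l)) 0).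
  by apply: mxcvgD; apply: mxcvg_outer => //; cvg_arith.
by apply/matrixP=> i j; rewrite !mxE; case: (j == 0); ring.
Qed.

(** The product is x^(1 - a). For G^alpha the large eigenvalue x^-alpha thus grows too slowly to
    move the limit vector off the first axis, while for G itself x * x^-1 tends to 1. *)
Lemma cvg_at0_mul_powRV a : 0 < a -> a < 1 -> x * powR x^-1 a @[x --> (0:R)^'+] --> (0 : R).
Proof.
move=> a0 a1; have a1' : 0 < 1 - a by rewrite subr_gt0.
apply: cvg_trans (powR_cvg0 a1'); apply: near_eq_cvg; near=> x.
have x0 : 0 < x by near: x; exact: nbhs_right_gt.
have -> : powR x^-1 a = (powR x a)^-1 by rewrite -(powR_inv1 (ltW x0)) -powRrM mulN1r powRN.
by rewrite powRB ?(gt_eqF x0) ?implybT // powRr1 // ltW.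
Unshelve. all: by end_near. Qed.

Lemma cvg_at0_divff : x * x^-1 @[x --> (0:R)^'+] --> (1 : R).
Proof.
apply: (@cvg_trans _ ((fun=> 1 : R) @ (0:R)^'+)); last exact: cvg_cst.
apply: near_eq_cvg; near=> x.
have x0 : 0 < x by near: x; exact: nbhs_right_gt.
by rewrite divff // gt_eqF.
Unshelve. all: by end_near. Qed.

(** X tends to k e e^T, with k the left-hand side below. Its determinant vanishes, so the trace
    inequality becomes k^2 <= k Y_00 with Y = M^(1/q), and k > 0 cancels. *)
Lemma mean_trace_ineq_limit alpha p q c s :
  let M := (1 - alpha) *: outer 1 0 + alpha *: outer c s in
  0 < alpha -> alpha < 1 -> 0 < p -> 0 < q -> 0 < c -> c ^+ 2 + s ^+ 2 = 1 -> 0 < disc M ->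
  (forall P G, spd P -> spd G -> mean_trace_ineq alpha p q P G) ->
  powR (powR c alpha ^+ 2) p^-1 <= rpow M q^-1 0 0.
Proof.
move=> M a0 a1 p0 q0 c0 cs dM ineq.
have r0 : 0 < q / p by rewrite divr_gt0.
have [pV qV] : 0 < p^-1 /\ 0 < q^-1 by rewrite !invr_gt0.
have p10 : projector (outer 1 0 : 'M[R]_2) by apply: projector_outer; rewrite expr0n expr1n addr0.
pose P (x : R) := sp (outer 1 0) 1 (x ^+ 4).
pose G (x : R) := sp (tilt (s * x)) c x^-1.
have sP : \forall x \near (0:R)^'+, spd (P x).
  near=> x; have x0 : 0 < x by near: x; exact: nbhs_right_gt.
  by apply: spd_sp => //; rewrite exprn_gt0.
have sG : \forall x \near (0:R)^'+, spd (G x).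
  near=> x; have x0 : 0 < x by near: x; exact: nbhs_right_gt.
  by apply: spd_sp; rewrite ?invr_gt0 //; exact: projector_tilt.
have conj_spd (A B : R -> 'M[R]_2) :
    (\forall x \near (0:R)^'+, spd (A x)) -> (\forall x \near (0:R)^'+, spd (B x)) ->
    \forall x \near (0:R)^'+, spd (B x *m A x *m B x).
  by apply: filterS2 => x; apply: spd_conj.
have rpow_near (A : R -> 'M[R]_2) (t : R) : (\forall x \near (0:R)^'+, spd (A x)) ->
    \forall x \near (0:R)^'+, spd (rpow (A x) t).
  by apply: filterS => x; apply: spd_rpow.
have cF : mxcvg (0:R)^'+ (fun x => rpow (G x) alpha *m P x *m rpow (G x) alpha)
    (outer (powR c alpha) 0).
  rewrite -[X in outer _ X](mulr0 s).
  have h x : rpow (G x) alpha = sp (tilt (s * x)) (powR c alpha) (powR x^-1 alpha).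
    by rewrite rpow_sp //; exact: projector_tilt.
  by under eq_fun do rewrite h; apply: mxcvg_tilt_conj; exact: cvg_at0_mul_powRV.
have cQ : mxcvg (0:R)^'+ (fun x => G x *m P x *m G x) (outer c s).
  by rewrite -[X in outer _ X](mulr1 s); apply: mxcvg_tilt_conj; exact: cvg_at0_divff.
have cP : mxcvg (0:R)^'+ P (outer 1 0).
  rewrite [X in mxcvg _ _ X](_ : _ = 1 *: outer 1 0 + (0 * 0 * 0 * 0) *: (1%:M - outer 1 0)).
    apply: mxcvgD; apply: mxcvgZ; try by move=> i j; exact: cvg_cst.
    have h (x : R) : x ^+ 4 = x * x * x * x by ring.
    under eq_fun do rewrite h.
    by have := cvg_at0_id => c00; cvg_arith.
  by rewrite scale1r !mul0r scale0r addr0.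
have cX : mxcvg (0:R)^'+
    (fun x => rpow (rpow (G x) alpha *m P x *m rpow (G x) alpha) p^-1)
    (powR (powR c alpha ^+ 2) p^-1 *: outer 1 0).
  have e : outer (powR c alpha) 0 = sp (outer 1 0) (powR c alpha ^+ 2) 0.
    by rewrite /sp scale0r addr0; apply/matrixP=> i j; rewrite !mxE; do 2?case: ifP => _; ring.
  have -> : powR (powR c alpha ^+ 2) p^-1 *: outer 1 0 = rpow (outer (powR c alpha) 0) p^-1.
    by rewrite e rpow_sp // powR0 ?gt_eqF // /sp scale0r addr0.
  apply: mxcvg_rpow => //; first by apply: conj_spd => //; exact: rpow_near.
  by rewrite e disc_sp // subr0 divr_gt0 // normr_gt0 expf_eq0 /= gt_eqF // powR_gt0.
(* The limits of P and G P G are rank-one projections: positive powers fix them, and their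
   eigenvalues 1 and 0 are distinct, as continuity of the power requires. *)
have rank1 c' s' : c' ^+ 2 + s' ^+ 2 = 1 ->
    rpow (outer c' s') (q / p) = outer c' s' /\ 0 < disc (outer c' s').
  move=> /projector_outer p1; have e : outer c' s' = sp (outer c' s') 1 0.
    by rewrite /sp scale1r scale0r addr0.
  split; first by rewrite {1}e rpow_sp // powR1 powR0 ?gt_eqF.
  by rewrite e disc_sp // subr0 normr1 divr_gt0.
have [rP dP] : rpow (outer 1 0) (q / p) = outer 1 0 /\ 0 < disc (outer 1 0).
  by apply: rank1; rewrite expr0n expr1n addr0.
have [rQ dQ] := rank1 c s cs.
have cY : mxcvg (0:R)^'+ (fun x => rpow ((1 - alpha) *: rpow (P x) (q / p)
     + alpha *: rpow (G x *m P x *m G x) (q / p)) q^-1) (rpow M q^-1).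
  apply: mxcvg_rpow => //.
    have := conj_spd _ _ sP sG.
    apply: filterS2 sP => x sPx sQx.
    by apply: spdD; apply: spdZ; rewrite ?subr_gt0 //; apply: spd_rpow.
  apply: mxcvgD; apply: mxcvgZ; try exact: cvg_cst.
    by rewrite -[X in mxcvg _ _ X]rP; apply: mxcvg_rpow.
  by rewrite -[X in mxcvg _ _ X]rQ; apply: mxcvg_rpow => //; apply: conj_spd.
set k := powR (_ ^+ 2) _ in cX *; set Y := rpow M _ in cY *.
set Xf := (X in mxcvg _ X _) in cX; set Yf := (X in mxcvg _ X _) in cY.
have cL : \tr (Xf x) * \tr (Xf x) @[x --> (0:R)^'+] --> \tr (k *: outer 1 0) * \tr (k *: outer 1 0).
  by apply: cvgM; exact: cvg_mxtrace.
have cR : \tr (Xf x *m Yf x) + 2 * Num.sqrt (\det (Xf x) * \det (Yf x)) @[x --> (0:R)^'+] -->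
    \tr (k *: outer 1 0 *m Y) + 2 * Num.sqrt (\det (k *: outer 1 0) * \det Y).
  apply: cvgD; first by apply: cvg_mxtrace; exact: mxcvg_mul.
  apply: cvgM; first exact: cvg_cst.
  by apply: cvg_sqrt; apply: cvgM; exact: cvg_det.
have k0 : 0 < k by rewrite powR_gt0 // exprn_gt0 // powR_gt0.
have tk : \tr (k *: outer 1 0) = k by rewrite mxtrace2E !mxE /=; ring.
have tkY : \tr (k *: outer 1 0 *m Y) = k * Y 0 0.
  by rewrite mxtrace2E !mulmx2E !mxE /=; ring.
have dk : \det (k *: outer 1 0) = 0 by rewrite det2E !mxE /=; ring.
have near_le : \forall x \near (0:R)^'+, \tr (Xf x) * \tr (Xf x) <=
    \tr (Xf x *m Yf x) + 2 * Num.sqrt (\det (Xf x) * \det (Yf x)).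
  by apply: filterS2 sP sG => x sPx sGx; rewrite -expr2; apply: ineq.
rewrite tk in cL; rewrite tkY dk mul0r sqrtr0 mulr0 addr0 in cR.
by rewrite -(ler_pM2l k0); exact: (ler_cvg_to cL cR near_le).
Unshelve. all: by end_near. Qed.

End Family.

(** * Expansion near s = 0 and the bound on q/p *)

Section Exponents.
Variable R : realType.
Implicit Types (a b d x : R).

(** Follows from exp u >= 1 + u and ln (1 + u) <= u. This bound and the next agree with the power to
    first order and take the place of a Taylor expansion. *)
Lemma powR_1B_ge a x : 0 <= a -> x < 1 -> 1 - a * (x / (1 - x)) <= powR (1 - x) a.
Proof.
move=> a0 x1; have y0 : 0 < 1 - x by rewrite subr_gt0.
rewrite /powR gt_eqF //.
apply: le_trans (expR_ge1Dx _); rewrite lerD2l -mulrN; apply: ler_wpM2l => //.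
rewrite lerNl -lnV ?posrE //.
have e : (1 - x)^-1 = 1 + x / (1 - x) by field; rewrite gt_eqF.
rewrite [X in ln X]e; apply: le_ln1Dx; rewrite -subr_gt0.
have -> : x / (1 - x) - -1 = (1 - x)^-1 by field; rewrite gt_eqF.
by rewrite invr_gt0.
Qed.

Lemma powR_1B_le b d : 0 <= b -> 0 <= d -> d < 1 -> powR (1 - d) b <= (1 + b * d)^-1.
Proof.
move=> b0 d0 d1; have y0 : 0 < 1 - d by rewrite subr_gt0.
rewrite /powR gt_eqF // -[X in X <= _]invrK -expRN lef_pV2 ?posrE ?expR_gt0 //; last first.
  by rewrite ltr_wpDr // mulr_ge0.
apply: le_trans (expR_ge1Dx _); rewrite lerD2l -mulrN; apply: ler_wpM2l => //.
by rewrite lerNr le_ln1Dx // ltrN2.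
Qed.

(** M has trace 1 and determinant alpha (1 - alpha) s^2 = d (1 - d), so its eigenvalues are 1 - d >
    d. With d as parameter instead of s they are free of square roots. *)
Lemma rpow_mean_00 alpha b c s d (M := (1 - alpha) *: outer 1 0 + alpha *: outer c s) :
  0 < d -> d < 2^-1 -> c ^+ 2 + s ^+ 2 = 1 -> alpha * (1 - alpha) * s ^+ 2 = d * (1 - d) ->
  0 < disc M /\
  rpow M b 0 0 = powR (1 - d) b
     - (powR (1 - d) b - powR d b) / (1 - 2 * d) * (alpha * s ^+ 2 - d).
Proof.
move=> d0 d2 cs ds.
have c2 : c ^+ 2 = 1 - s ^+ 2 by rewrite -cs; ring.
have M00 : M 0 0 = 1 - alpha * s ^+ 2.
  by rewrite !mxE /= -[c * c]expr2 c2; ring.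
have tM : \tr M = 1.
  by rewrite mxtrace2E M00 !mxE /=; ring.
have dM : \det M = d * (1 - d).
  rewrite -ds det2E M00 !mxE /=; apply/eqP; rewrite -subr_eq0; apply/eqP.
  transitivity (alpha * s ^+ 2 * alpha * (1 - c ^+ 2 - s ^+ 2)); first by ring.
  by rewrite c2; ring.
have discM : disc M = 2^-1 - d.
  rewrite /disc tM dM (_ : _ - _ = (2^-1 - d) ^+ 2); last by field.
  by rewrite sqrtr_sqr ger0_norm // subr_ge0 ltW.
have e1 : eig1 M = 1 - d by rewrite /eig1 tM discM; field.
have e2 : eig2 M = d by rewrite /eig2 tM discM; field.
rewrite discM subr_gt0; split=> //.
rewrite /rpow /slope e1 e2 mxE [(_ *: M) _ _]mxE [_%:M _ _]mxE M00 mulr1n.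
rewrite (_ : 1 - d - d = 1 - 2 * d); last by ring.
by ring.
Qed.

Section Bound.
Variables alpha p q : R.
Hypotheses (a0 : 0 < alpha) (a1 : alpha < 1) (p0 : 0 < p) (q0 : 0 < q).
Hypothesis ineq : forall P G : 'M[R]_2, spd P -> spd G -> mean_trace_ineq alpha p q P G.

(* [d] is the smaller eigenvalue of the mean in [mean_trace_ineq_limit] and [z] is
   [s ^+ 2]; it is obtained by subtracting the limit inequality from 1 and dividing by [d]. *)
Lemma mean_trace_ineq_quot d (z := d * (1 - d) / (alpha * (1 - alpha))) (b := q^-1) :
  0 < d -> d < 2^-1 -> d < alpha -> d < alpha * (1 - alpha) ->
  b * (1 + b * d)^-1 + (1 - b * (d * (1 - d)^-1) - powR d b) * ((alpha - d) / (1 - alpha))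
    <= p^-1 / (1 - alpha) * ((1 - d) * (1 - z)^-1).
Proof.
move=> d0 d2 da daa.
have a1' : 0 < 1 - alpha by rewrite subr_gt0.
have aa : 0 < alpha * (1 - alpha) by rewrite mulr_gt0.
have d1 : d < 1 by lra.
have d1' : 0 < 1 - d by rewrite subr_gt0.
have b0 : 0 < b by rewrite invr_gt0.
have z0 : 0 < z by rewrite divr_gt0 // mulr_gt0.
have z1 : z < 1 by rewrite ltr_pdivrMr // mul1r; nra.
have z1' : 0 < 1 - z by rewrite subr_gt0.
have cs : Num.sqrt (1 - z) ^+ 2 + Num.sqrt z ^+ 2 = 1.
  by rewrite !sqr_sqrtr ?ltW // subrK.
have ds : alpha * (1 - alpha) * Num.sqrt z ^+ 2 = d * (1 - d).
  by rewrite sqr_sqrtr ?ltW // mulrC divfK // gt_eqF.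
have [dM r00] := rpow_mean_00 b d0 d2 cs ds.
have c0 : 0 < Num.sqrt (1 - z) by rewrite sqrtr_gt0.
have := mean_trace_ineq_limit a0 a1 p0 q0 c0 cs dM ineq.
rewrite r00 sqr_sqrtr ?(ltW z0) //.
have -> : powR (powR (Num.sqrt (1 - z)) alpha ^+ 2) p^-1 = powR (1 - z) (alpha / p).
  by rewrite expr2 -powRM ?sqrtr_ge0 // -expr2 sqr_sqrtr ?(ltW z1') // -powRrM.
have lo := powR_1B_ge (ltW (divr_gt0 a0 p0)) z1.
have up := powR_1B_le (ltW b0) (ltW d0) d1.
have lo2 := powR_1B_ge (ltW b0) d1.
have d12 : 0 < 1 - 2 * d by lra.
(* This sign lets the lower bound on the slope be multiplied in; it comes from d < alpha. *)
have g0 : 0 <= alpha * z - d.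
  rewrite (_ : _ - _ = d * (alpha - d) / (1 - alpha)); last first.
    by rewrite /z; field; rewrite !gt_eqF.
  by rewrite divr_ge0 ?ltW // mulr_gt0 // subr_gt0.
(* Dividing the nonnegative numerator by 1 - 2 d, which is below 1, can only increase it. *)
have sl : 1 - b * (d / (1 - d)) - powR d b <= (powR (1 - d) b - powR d b) / (1 - 2 * d).
  have num0 : 0 <= powR (1 - d) b - powR d b.
    by rewrite subr_ge0; apply: ge0_ler_powR; rewrite ?nnegrE ?ltW //; lra.
  apply: (@le_trans _ _ (powR (1 - d) b - powR d b)); first by rewrite lerD2r.
  by rewrite ler_pdivlMr //; nra.
move=> main.
have sl2 := ler_wpM2r g0 sl.
have main2 : 1 - alpha / p * (z / (1 - z)) <=
    (1 + b * d)^-1 - (1 - b * (d / (1 - d)) - powR d b) * (alpha * z - d).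
  by apply: le_trans lo _; apply: le_trans main _; apply: lerB.
(* After collecting, each term of [main2] has a factor d: 1 - 1/(1 + b d) = b d/(1 + b d), alpha z -
   d = d (alpha - d)/(1 - alpha) and alpha z = d (1 - d)/(1 - alpha). *)
rewrite -(ler_pM2l d0) -subr_ge0.
rewrite -subr_ge0 in main2; move: main2; congr (0 <= _).
have bd : 0 < 1 + b * d by rewrite addr_gt0 // mulr_gt0.
move: (powR d b) => w.
have z1n : alpha * (1 - alpha) - d * (1 - d) != 0.
  have -> : alpha * (1 - alpha) - d * (1 - d) = (1 - z) * (alpha * (1 - alpha)).
    by rewrite /z; field; rewrite !gt_eqF.
  by rewrite gt_eqF // mulr_gt0.
rewrite /z; field.
by rewrite z1n !gt_eqF.
Qed.

(** As d tends to 0, d^(1/q) vanishes and the quotient inequality becomes 1/q + alpha/(1 - alpha) <=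
    1/(p (1 - alpha)); multiplying by q (1 - alpha) gives the bound. *)
Lemma exponent_bound : 1 + alpha * (q - 1) <= q / p.
Proof.
have a1' : 0 < 1 - alpha by rewrite subr_gt0.
have aa : 0 < alpha * (1 - alpha) by rewrite mulr_gt0.
have b0 : 0 < q^-1 by rewrite invr_gt0.
have c0 : x @[x --> (0:R)^'+] --> (0 : R) := @cvg_at0_id R.
have cpow : powR x q^-1 @[x --> (0:R)^'+] --> (0 : R) by exact: powR_cvg0.
have c1 : (1 + q^-1 * x)^-1 @[x --> (0:R)^'+] --> (1 : R).
  rewrite -[X in _ --> X]invr1; apply: cvgV; first exact: oner_neq0.
  rewrite [X in _ --> X](_ : _ = 1 + q^-1 * 0); last by ring.
  by cvg_arith.
have c2 : (1 - x)^-1 @[x --> (0:R)^'+] --> (1 : R).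
  rewrite -[X in _ --> X]invr1; apply: cvgV; first exact: oner_neq0.
  rewrite [X in _ --> X](_ : _ = 1 - 0); last by ring.
  by cvg_arith.
have c3 : (1 - x * (1 - x) / (alpha * (1 - alpha)))^-1 @[x --> (0:R)^'+] --> (1 : R).
  rewrite -[X in _ --> X]invr1; apply: cvgV; first exact: oner_neq0.
  rewrite [X in _ --> X](_ : _ = 1 - 0 * (1 - 0) / (alpha * (1 - alpha))); last by ring.
  by cvg_arith.
have cL : q^-1 * (1 + q^-1 * x)^-1 + (1 - q^-1 * (x * (1 - x)^-1) - powR x q^-1)
      * ((alpha - x) / (1 - alpha)) @[x --> (0:R)^'+] -->
    q^-1 * 1 + (1 - q^-1 * (0 * 1) - 0) * ((alpha - 0) / (1 - alpha)) by cvg_arith.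
have cR : p^-1 / (1 - alpha) * ((1 - x) * (1 - x * (1 - x) / (alpha * (1 - alpha)))^-1)
      @[x --> (0:R)^'+] --> p^-1 / (1 - alpha) * ((1 - 0) * 1) by cvg_arith.
have le_lim := ler_cvg_to cL cR.
have : q^-1 * 1 + (1 - q^-1 * (0 * 1) - 0) * ((alpha - 0) / (1 - alpha)) <=
    p^-1 / (1 - alpha) * ((1 - 0) * 1).
  apply: le_lim; near=> x; apply: mean_trace_ineq_quot.
  - by near: x; exact: nbhs_right_gt.
  - by near: x; apply: nbhs_right_lt; rewrite invr_gt0.
  - by near: x; exact: nbhs_right_lt.
  - by near: x; exact: nbhs_right_lt.
rewrite -subr_ge0 => h.
rewrite -subr_ge0; move: (mulr_ge0 (ltW (mulr_gt0 q0 a1')) h); congr (0 <= _).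
by field; rewrite !gt_eqF.
Unshelve. all: by end_near. Qed.

End Bound.
End Exponents.

Theorem theorem4p24 (R : realType) (alpha p q : R) :
  0 < alpha -> alpha < 1 -> 0 < p -> 0 < q ->
  (forall A B : 'M[R[i]]_2, posdef A -> posdef B ->
     near_le (SG alpha p A B) (Amean alpha q A B)) ->
  1 + Num.max (alpha * (q - 1)) ((1 - alpha) * (q - 1)) <= q / p /\
  (1 <= q ->
     1 + Num.max alpha (1 - alpha) * (q - 1) <= q / p /\
     1 <= 1 + Num.max alpha (1 - alpha) * (q - 1)) /\
  (q <= 1 ->
     1 - Num.min alpha (1 - alpha) * (1 - q) <= q / p /\
     Num.max alpha (1 - alpha) <= 1 - Num.min alpha (1 - alpha) * (1 - q)).
Proof.
move=> a0 a1 p0 q0 near.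
have h1 := exponent_bound a0 a1 p0 q0 (near_mean_trace_ineq a0 a1 p0 near).
have a0' : 0 < 1 - alpha by rewrite subr_gt0.
have a1' : 1 - alpha < 1 by rewrite gtrBl.
have h2 := exponent_bound a0' a1' p0 q0 (near_mean_trace_ineq_swap a0 a1 p0 near).
split; first by case: (leP (alpha * (q - 1))) => _.
(* The sign of q - 1 decides whether the larger bound carries the maximum or the minimum of alpha
   and 1 - alpha; these two add up to 1. *)
by split=> q1; case: (leP alpha (1 - alpha)) => ha; split; nra.
Qed.
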